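(* Let $n\ge 1$ be an integer, let $q$ be a prime power, let $\mathcal{C}\subseteq \mathrm{U}(n,\mathbb{F}_q)$ be a linear flag-rank-metric code with minimum distance $\delta=3$, and let $\alpha$ be its codimension. Then $\mathcal{C}$ is perfect if and only if \[ n=\frac{q^\alpha-1}{q-1}. \] Moreover, necessarily $\alpha\ge \delta$ (that is, $\alpha\ge 3$).
   Context: $\mathbb{F}_q$ is the finite field with $q$ elements. $\mathrm{U}(n,\mathbb{F}_q)$ is the $\mathbb{F}_q$-vector space of $n\times n$ upper triangular matrices over $\mathbb{F}_q$; it has dimension $\frac{n(n+1)}{2}$. For $M\in \mathrm{U}(n,\mathbb{F}_q)$ and $1\le i\le n$, $M_{[i]}$ is the $i\times(n-i+1)$ submatrix of $M$ obtained by deleting the first $i-1$ columns and the last $n-i$ rows (i.e. rows $1,\dots,i$ and columns $i,\dots,n$). The flag-rank weight of $M$ is $\mathrm{fr}(M)=\sum_{i=1}^{n}\mathrm{rk}(M_{[i]})$; the flag-rank distance is $\mathrm{d}_{\mathrm{fr}}(A,B)=\mathrm{fr}(A-B)$. A linear flag-rank-metric code is an $\mathbb{F}_q$-subspace $\mathcal{C}$ of $\mathrm{U}(n,\mathbb{F}_q)$; its minimum (flag-rank) distance, defined when $\mathcal{C}\neq\{\boldsymbol{0}\}$, is $\delta=\min\{\mathrm{fr}(M):M\in\mathcal{C}\setminus\{\boldsymbol{0}\}\}$. Its codimension is $\frac{n(n+1)}{2}-\dim_{\mathbb{F}_q}(\mathcal{C})$. Let $b_q(n,t)=|\{A\in \mathrm{U}(n,\mathbb{F}_q):\mathrm{fr}(A)\le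 t\}|$. A code $\mathcal{C}$ with minimum distance $\delta$ is perfect if $|\mathcal{C}|\,b_q(n,t)=q^{\frac{n(n+1)}{2}}$, where $t=\left\lfloor\frac{\delta-1}{2}\right\rfloor$. *)

(* Defs.v *)
From mathcomp Require Import all_boot all_order all_algebra all_field.

Set Implicit Arguments.
Unset Strict Implicit.
Unset Printing Implicit Defensive.

Import GRing.Theory.

(* [is_trig_mx] is lower triangularity, hence the transpose. *)
Definition upper_mx (F : finFieldType) (n : nat) : pred 'M[F]_n :=
  fun A => is_trig_mx A^T%R.
Arguments upper_mx {F n}.

Lemma flag_col_subproof (n : nat) (i : 'I_n) (c : 'I_(n - i)) : i + c < n.
Proof. by rewrite -ltn_subRL. Qed.

Definition flag_col (n : nat) (i : 'I_n) (c : 'I_(n - i)) : 'I_n :=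
  Ordinal (flag_col_subproof c).

(* Indices are 0-based: this is M_[i+1], with rows 0, ..., i and
   columns i, ..., n - 1 of M. *)
Definition flag_submx (F : finFieldType) (n : nat) (M : 'M[F]_n) (i : 'I_n) :
    'M[F]_(i.+1, n - i) :=
  mxsub (widen_ord (ltn_ord i)) (@flag_col n i) M.

Definition fr (F : finFieldType) (n : nat) (M : 'M[F]_n) : nat :=
  \sum_(i < n) \rank (flag_submx M i).

(* Never holds for the zero code, whose minimum distance is undefined. *)
Definition min_distance (F : finFieldType) (n : nat) (C : {vspace 'M[F]_n})
    (d : nat) : Prop :=
  (exists M, [/\ M \in C, M != 0%R & fr M = d]) /\
  (forall M, M \in C -> M != 0%R -> d <= fr M).

Definition codim (F : finFieldType) (n : nat) (C : {vspace 'M[F]_n}) : nat :=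
  (n * n.+1) %/ 2 - \dim C.

Definition ball_size (F : finFieldType) (n t : nat) : nat :=
  #|[set A : 'M[F]_n | upper_mx A & fr A <= t]|.

Definition perfect (F : finFieldType) (n : nat) (C : {vspace 'M[F]_n}) : Prop :=
  exists d : nat, min_distance C d /\
    #|C| * ball_size F n ((d - 1) %/ 2) = #|F| ^ ((n * n.+1) %/ 2).

(* Main.v *)
(* A nonzero entry (a, b) of an upper triangular matrix lies in the i-th flag
   submatrix for every a <= i <= b, so the matrices of weight at most 1 are
   exactly the multiples c E_ii of the diagonal units.  Hence the ball of radius
   1 has 1 + n (q - 1) elements, which turns perfection into 1 + n (q - 1) =
   q^alpha.  For alpha >= 3, an upper triangular matrix supported on the top left
   2 x 2 corner has weight at most 2, so a codeword is determined by its entries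
   in the n (n + 1) / 2 - 3 other positions of the triangle. *)
Require Import Defs.
From mathcomp Require Import all_boot all_order all_algebra all_field.
From mathcomp Require Import zify.

Set Implicit Arguments.
Unset Strict Implicit.
Unset Printing Implicit Defensive.

Import GRing.Theory.

Lemma upper_mxP (F : finFieldType) (n : nat) (A : 'M[F]_n) :
  reflect (forall i j : 'I_n, j < i -> A i j = 0%R) (upper_mx A).
Proof.
apply: (iffP is_trig_mxP) => A0 i j ji; first by rewrite -(A0 j i ji) mxE.
by rewrite mxE A0.
Qed.

(** Such a matrix is its column [j0] times a unit row vector, a product through dimension 1. *)
Lemma mxrank_le1_col_support (F : fieldType) (m n : nat) (A : 'M[F]_(m, n))
    (j0 : 'I_n) :
  (forall i j, j != j0 -> A i j = 0%R) -> \rank A <= 1.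
Proof.
move=> A0; suff -> : A = (col j0 A *m delta_mx ord0 j0)%R.
  exact: mulmx_max_rank.
apply/matrixP => i j; rewrite mxE big_ord1 !mxE eqxx /=.
by have [->|/A0->] := eqVneq j j0; rewrite ?mulr1 ?mulr0.
Qed.

Lemma flag_submx_eq0 (F : finFieldType) (n : nat) (M : 'M[F]_n) (i : 'I_n) :
  (forall a b : 'I_n, a <= i -> i <= b -> M a b = 0%R) -> flag_submx M i = 0%R.
Proof.
move=> M0; apply/matrixP => a b; rewrite !mxE; apply: M0 => /=.
  by rewrite -ltnS.
exact: leq_addr.
Qed.

Lemma flag_submx_neq0 (F : finFieldType) (n : nat) (M : 'M[F]_n)
    (a i b : 'I_n) :
  a <= i -> i <= b -> M a b != 0%R -> flag_submx M i != 0%R.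
Proof.
move=> ai ib; apply: contraNneq => /matrixP M0.
have bi : b - i < n - i by rewrite ltn_sub2r // (leq_ltn_trans ib).
have := M0 (Ordinal (ai : a < i.+1)) (Ordinal bi); rewrite !mxE => <-.
by apply/eqP; congr (M _ _); apply/val_inj => //=; rewrite subnKC.
Qed.

(** Each nonzero flag submatrix adds at least 1 to the weight. *)
Lemma fr_le1_inj (F : finFieldType) (n : nat) (M : 'M[F]_n) (i j : 'I_n) :
  fr M <= 1 -> flag_submx M i != 0%R -> flag_submx M j != 0%R -> i = j.
Proof.
rewrite -!mxrank_eq0 -!lt0n => + i0 j0; apply: contraTeq => ij.
rewrite -ltnNge /fr (bigD1 i) //= (bigD1 j) /=; last by rewrite eq_sym.
by rewrite addnA (leq_trans _ (leq_addr _ _)) // (leq_add i0 j0).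
Qed.

(** The entry (i, i) lies in the [i]-th flag submatrix only, in its column 0. *)
Lemma fr_scale_delta (F : finFieldType) (n : nat) (i : 'I_n) (c : F) :
  fr (c *: delta_mx i i)%R <= 1.
Proof.
rewrite /fr (bigD1 i) //= big1 ?addn0 => [|j ji]; last first.
  rewrite flag_submx_eq0 ?mxrank0 // => a b aj jb; rewrite !mxE.
  have [ai|] := eqVneq a i; last by rewrite mulr0.
  have [bi|] := eqVneq b i; last by rewrite mulr0.
  by case/eqP: ji; apply/val_inj/eqP; rewrite eqn_leq -{1}bi jb -{1}ai aj.
have hi : 0 < n - i by rewrite subn_gt0.
apply: (mxrank_le1_col_support (j0 := Ordinal hi)) => a b b0; rewrite !mxE.
suff /negPf-> : flag_col b != i by rewrite andbF mulr0.
apply: contraNneq b0 => /(congr1 val)/= bi.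
by apply/eqP/val_inj => /=; lia.
Qed.

Lemma upper_fr_le1E (F : finFieldType) (n : nat) :
  [set A : 'M[F]_n | upper_mx A & fr A <= 1] =
  0%R |: [set (p.1 *: delta_mx p.2 p.2)%R | p in setX [set~ 0%R : F] [set: 'I_n]].
Proof.
apply/setP => A; rewrite !inE; apply/andP/orP => [[/upper_mxP Aup frA]|].
  have [->|A0] := eqVneq A 0%R; [by left | right].
  have [[a b] /= ab0] : exists p : 'I_n * 'I_n, A p.1 p.2 != 0%R.
    apply/existsP; apply: contraNT A0; rewrite negb_exists => /forallP A0.
    by apply/eqP/matrixP => i j; rewrite mxE; apply/eqP/negPn/(A0 (i, j)).
  have le (i j : 'I_n) : A i j != 0%R -> i <= j.
    by rewrite leqNgt; apply: contraNN => /Aup->.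
  (* A nonzero entry (i, j) makes the [i]-th and the [j]-th flag submatrices nonzero, as (a, b) does
     the [a]-th; weight at most 1 forces all these indices to agree. *)
  have eqa (i j : 'I_n) : A i j != 0%R -> i = a /\ j = a.
    move=> ij0; have aF := flag_submx_neq0 (leqnn a) (le _ _ ab0) ab0.
    split; apply: (fr_le1_inj frA) aF.
      exact: flag_submx_neq0 (leqnn i) (le _ _ ij0) ij0.
    exact: flag_submx_neq0 (le _ _ ij0) (leqnn j) ij0.
  have [_ ba] := eqa _ _ ab0; rewrite ba in ab0.
  apply/imsetP; exists (A a a, a); first by rewrite !inE ab0.
  apply/matrixP => i j; rewrite !mxE /=.
  have [/eqa[-> ->]|/negPn/eqP A0'] := boolP (A i j != 0%R).
    by rewrite eqxx mulr1.
  rewrite A0'; have [ia|] := eqVneq i a; last by rewrite mulr0.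
  have [ja|] := eqVneq j a; last by rewrite mulr0.
  by rewrite ia ja in A0'; rewrite A0' eqxx in ab0.
case=> [/eqP->|/imsetP[[c i] _ ->]] /=; split.
- by apply/upper_mxP => i j _; rewrite mxE.
- by rewrite /fr big1 // => i _; rewrite flag_submx_eq0 ?mxrank0 // => *; rewrite mxE.
- apply/upper_mxP => a b ba; rewrite !mxE.
  have [ai|] := eqVneq a i; last by rewrite mulr0.
  have [bi|] := eqVneq b i; last by rewrite mulr0.
  by rewrite ai bi ltnn in ba.
- exact: fr_scale_delta.
Qed.

Lemma ball_size1 (F : finFieldType) (n : nat) :
  ball_size F n 1 = (n * (#|F| - 1)).+1.
Proof.
rewrite /ball_size upper_fr_le1E cardsU1.
have -> : 0%R \notin [set (p.1 *: delta_mx p.2 p.2 : 'M[F]_n)%R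
                     | p in setX [set~ 0%R] [set: 'I_n]].
  apply/imsetP => -[[c i]]; rewrite !inE andbT => /= c0 /matrixP/(_ i i).
  by rewrite !mxE eqxx mulr1 => cE; rewrite -cE eqxx in c0.
rewrite card_in_imset => [|[c i] [d j]].
  by rewrite cardsX cardsT cardsC1 card_ord mulnC subn1.
(* Injectivity is read off at the entry (i, i): for i distinct from j it would give c = 0. *)
rewrite !inE !andbT => /= c0 _ /matrixP/(_ i i); rewrite !mxE eqxx mulr1 andbb.
by have [->|_] := eqVneq i j => cE; rewrite cE ?mulr1 // mulr0 eqxx in c0 *.
Qed.

(** Restriction to [T] is injective on [C], so |C| is at most |F|^|T|; comparing exponents replaces
    a rank argument. *)
Lemma dim_le_card_determining (F : finFieldType) (m n : nat)
    (C : {vspace 'M[F]_(m, n)}) (T : {set 'I_m * 'I_n}) :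
  (forall M, M \in C -> (forall p, p \in T -> M p.1 p.2 = 0%R) -> M = 0%R) ->
  \dim C <= #|T|.
Proof.
move=> det; rewrite -(leq_exp2l _ _ (card_finNzRing_gt1 F)) -card_vspace.
pose f (M : 'M[F]_(m, n)) := [ffun p : {p | p \in T} => M (val p).1 (val p).2].
have -> : #|T| = #|{: {p | p \in T}}| by rewrite card_sig.
rewrite -card_ffun; apply: (@leq_card_in _ _ f) => M N MC NC /ffunP fMN.
apply/eqP; rewrite -subr_eq0; apply/eqP/det; first exact: rpredB.
by move=> p pT; have := fMN (exist _ p pT); rewrite !ffunE !mxE /= => ->; rewrite subrr.
Qed.

Lemma card_triangle (n : nat) :
  #|[set p : 'I_n * 'I_n | p.1 <= p.2]| = n * n.+1 %/ 2.
Proof.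
have -> : n * n.+1 %/ 2 = \sum_(j < n) j.+1.
  elim: n => [|n IHn]; first by rewrite big_ord0.
  by rewrite big_ord_recr /= -IHn; lia.
rewrite -sum1dep_card
  -(pair_big_dep xpredT (fun i j : 'I_n => i <= j) (fun _ _ => 1)) /=.
(* Counting by columns: column [j] of the triangle has j + 1 entries. *)
rewrite (exchange_big_dep xpredT) //=; apply: eq_bigr => j _.
by rewrite -(big_ord_widen n (fun=> 1) (ltn_ord j)) sum1_card card_ord.
Qed.

(** Only the first two flag submatrices can be nonzero: the first has a single row, and the second
    is supported on its column 0. *)
Lemma fr_corner_le2 (F : finFieldType) (n : nat) (M : 'M[F]_n) :
  (forall a b : 'I_n, 1 < b -> M a b = 0%R) -> upper_mx M -> fr M <= 2.
Proof.
case: n M => [|[|n]] M M0 /upper_mxP Mup.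
- by rewrite /fr big_ord0.
- by rewrite /fr big_ord1 (leq_trans (rank_leq_row _)).
rewrite /fr !big_ord_recl big1 => [|i _]; last first.
  by rewrite flag_submx_eq0 ?mxrank0 // => a b _ ib; apply: M0; apply: leq_trans ib.
rewrite addn0 (@leq_add _ _ 1 1) ?rank_leq_row //.
have h : 0 < n.+2 - lift ord0 (ord0 : 'I_n.+1) by [].
apply: (mxrank_le1_col_support (j0 := Ordinal h)) => a b b0; rewrite !mxE.
apply: M0 => /=; rewrite /bump /= addnC addn1 ltnS lt0n.
by apply: contraNneq b0 => b0; apply/eqP/val_inj.
Qed.

Lemma dim_min_distance3 (F : finFieldType) (n : nat) (C : {vspace 'M[F]_n}) :
  {subset C <= upper_mx} -> min_distance C 3 -> \dim C + 3 <= n * n.+1 %/ 2.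
Proof.
case: n C => [|[|n]] C hC [[M0 [M0C M00 frM0]] frC].
(* For n at most 1 no matrix has weight 3: the sum is empty or the rank of a single row. *)
- by move: frM0; rewrite /fr big_ord0.
- by move: frM0 (rank_leq_row (flag_submx M0 ord0)); rewrite /fr big_ord1 => ->.
pose o := ord0 : 'I_n.+2; pose e := lift ord0 (ord0 : 'I_n.+1).
pose U := [set p : 'I_n.+2 * 'I_n.+2 | p.1 <= p.2].
pose K := [set (o, o); (o, e); (e, e)].
have KU : K \subset U by apply/subsetP => p; rewrite !inE => /orP[/orP[]|] /eqP->.
have K3 : #|K| = 3 by rewrite /K setUC cardsU1 cards2 !inE.
rewrite -card_triangle -/U -(cardsID K U) (setIidPr KU) K3 addnC leq_add2l.
apply: dim_le_card_determining => M MC M0'.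
apply/eqP; apply: contraT => Mn0; move: (frC M MC Mn0).
rewrite ltnNge fr_corner_le2 //; last exact: hC.
move=> a b b1; have [ab|ba] := leqP a b; last by move/upper_mxP: (hC M MC); apply.
apply: (M0' (a, b)); rewrite !inE ab andbT !xpair_eqE.
(* The positions in [K] lie in columns 0 and 1, so (a, b) with b > 1 is outside [K]. *)
have b_neq c : c <= 1 -> (b == c :> nat) = false by lia.
by rewrite -!val_eqE /= !b_neq ?andbF.
Qed.

Theorem theorem5p4 (n q : nat) (F : finFieldType) (C : {vspace 'M[F]_n})
    (alpha : nat)
    (hn : 1 <= n) (hq : #|F| = q)
    (hC : {subset C <= @upper_mx F n})
    (hdelta : min_distance C 3)
    (halpha : codim C = alpha) :
  (perfect C <->
     (n%:R = (q%:R ^+ alpha - 1) / (q%:R - 1) :> rat)%R) /\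
  3 <= alpha.
Proof.
have dimC := dim_min_distance3 hC hdelta.
(* By [dimC] the truncated subtraction in [codim] is exact. *)
have dimE : \dim C + alpha = n * n.+1 %/ 2 by rewrite -halpha /codim; lia.
split; last by lia.
have q1 : 1 < q by rewrite -hq card_finNzRing_gt1.
(* The radius is 1; cancelling |C| = q^(dim C) leaves q^alpha on the right. *)
have ballE : #|C| * ball_size F n ((3 - 1) %/ 2) = #|F| ^ (n * n.+1 %/ 2) <->
    (n * (q - 1)).+1 = q ^ alpha.
  rewrite ball_size1 card_vspace hq -dimE expnD; split=> [/eqP|->] //.
  by rewrite eqn_pmul2l ?expn_gt0 ?(ltnW q1) // => /eqP.
have ratE : (n * (q - 1)).+1 = q ^ alpha <->
    (n%:R = (q%:R ^+ alpha - 1) / (q%:R - 1) :> rat)%R.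
  (* Since q > 1, the rational denominator can be cleared, which gives back an identity of
     naturals. *)
  have q0 : (q%:R - 1 != 0 :> rat)%R.
    by rewrite -(natrB _ (ltnW q1)) Num.Theory.pnatr_eq0 -lt0n subn_gt0.
  split=> [E|/(congr1 (fun x => x * (q%:R - 1))%R)].
    apply/(canRL (mulfK q0)); rewrite -natrX -E -natr1 addrK natrM natrB //.
    exact: ltnW.
  rewrite divfK // -(natrB _ (ltnW q1)) -natrM -natrX => /eqP.
  by rewrite eq_sym subr_eq natr1 Num.Theory.eqr_nat => /eqP<-.
rewrite -ratE -ballE; split=> [[d [[[M [MC M0 frM]] frC]]]|]; last by exists 3.
(* The distance inside [perfect] is existentially quantified; two minimum distances of one code
   bound each other, so it is 3. *)
suff -> : d = 3 by [].
case: hdelta => [[N [NC N0 frN]] frC3]; apply/eqP.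
by rewrite eqn_leq -{1}frN frC // -frM frC3.
Qed.
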